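(* Let $d \geq 0$ be an integer. Let $k, m \geq 2$ be integers such that $m \geq 4 d$. Then, for $m \leq k$, $$L_{2 d + 1} (k, m) = f^{(k + 2 d, k, 1^{m - 2 d})} + \sum_{r = 0}^{d - 1} \sum_{j = 0}^r f^{(k + 2 r, k + 2 j, m - 2 (r + j))},$$ where $L_{2d+1}(k,m) = \sum_{j=0}^{2d} f^{(k+j,k+j,1^{m-2j})}$.
   Context: For a partition $\lambda\vdash n$, $f^\lambda$ denotes the number of standard Young tableaux of shape $\lambda$; equivalently, $f^\lambda$ is the degree of the irreducible complex character of the symmetric group $\Sigma_n$ labeled by $\lambda$. In $(a,b,1^t)$ the notation $1^t$ means $t$ parts equal to $1$ (none if $t=0$); parts equal to zero in a partition are allowed. Empty sums are zero. *)

(* Defs.v *)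
From mathcomp Require Import all_boot.

Set Implicit Arguments.
Unset Strict Implicit.
Unset Printing Implicit Defensive.

(* A partition is given by its weakly decreasing sequence of parts, possibly
   with trailing zeros. A cell is a row i together with a column below the
   i-th part; rows and columns are numbered from 0. *)
Definition young_cell (lam : seq nat) : Type :=
  {i : 'I_(size lam) & 'I_(nth 0 lam i)}.

Definition cell_row (lam : seq nat) (c : young_cell lam) : nat := tag c.
Definition cell_col (lam : seq nat) (c : young_cell lam) : nat := tagged c.

(* Entries are 0, ..., n - 1 instead of 1, ..., n; injectivity suffices, as
   there are n = sumn lam cells. *)
Definition standard_tableau (lam : seq nat)
    (T : {ffun young_cell lam -> 'I_(sumn lam)}) : bool :=
  [&& injectiveb T,
      [forall c, forall c',
        (cell_row c == cell_row c') && (cell_col c < cell_col c')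
          ==> (T c < T c')] &
      [forall c, forall c',
        (cell_col c == cell_col c') && (cell_row c < cell_row c')
          ==> (T c < T c')]].

Definition num_syt (lam : seq nat) : nat :=
  #|[set T : {ffun young_cell lam -> 'I_(sumn lam)} | standard_tableau T]|.

Definition two_row_ones (a b t : nat) : seq nat := [:: a, b & nseq t 1].

(* L_(2d+1)(k, m), for m >= 4d: the subtraction is then not truncated. *)
Definition L_odd (d k m : nat) : nat :=
  \sum_(0 <= j < (2 * d).+1) num_syt (two_row_ones (k + j) (k + j) (m - 2 * j)).

(* Main.v *)
Require Import Defs.
From mathcomp Require Import all_boot all_algebra.
From mathcomp Require Import zify ring.

Set Implicit Arguments.
Unset Strict Implicit.
Unset Printing Implicit Defensive.

Import GRing.Theory Num.Theory.

(* Removing the cell that holds the largest entry gives the branching rule for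
   num_syt, from which the hook formulas for (a, b, c) and (a, b, 1^t) follow by
   induction on the size. They yield, for a >= b + 2 and b >= c >= 4,
     f(a,b,c) = f(a,b,1^c) - f(a+2,b,1^(c-2)) - f(a,b+2,1^(c-2))
                + f(a+2,b+2,1^(c-4)),
   and, for a = b, the same identity with - f(a,a+2,1^(c-2)) replaced by
   + f(a+1,a+1,1^(c-2)). For a = k + 2d and a + b + c fixed, the right-hand side
   telescopes along b = k, k + 2, ..., a; this is the step from d to d + 1. *)

(** * Monotone labelings of finite families of points *)

(** Keeping the index type [C] apart from the positions in [X] allows diagrams with different cell
    types, or with a cell deleted, to be compared by position. When [R] is a strict order and [n] is
    [#|C|], this counts linear extensions of the order pulled back along [p]. *)
Definition num_linext (X : Type) (R : rel X) (C : finType) (p : C -> X)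
    (n : nat) : nat :=
  #|[set T : {ffun C -> 'I_n} | injectiveb T &&
      [forall x, forall y, R (p x) (p y) ==> (T x < T y)]]|.

Lemma linextP (X : Type) (R : rel X) (C : finType) (p : C -> X) (n : nat)
    (T : {ffun C -> 'I_n}) :
  reflect (injective T /\ forall x y, R (p x) (p y) -> T x < T y)
    (injectiveb T && [forall x, forall y, R (p x) (p y) ==> (T x < T y)]).
Proof.
apply: (iffP andP) => -[/injectiveP injT RT]; split=> //.
  by move=> x y Rxy; have /forallP/(_ y)/implyP := forallP RT x; apply.
by apply/forallP=> x; apply/forallP=> y; apply/implyP=> /RT.
Qed.

Lemma num_linext_bij (X : Type) (R : rel X) (C C' : finType) (p : C -> X)
    (p' : C' -> X) (n : nat) (f : C -> C') :
  bijective f -> (forall x, p' (f x) = p x) ->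
  num_linext R p n = num_linext R p' n.
Proof.
move=> [g fK gK] pf; rewrite /num_linext.
pose h (T : {ffun C' -> 'I_n}) : {ffun C -> 'I_n} := [ffun x => T (f x)].
have bij_h : bijective h.
  exists (fun T : {ffun C -> 'I_n} => [ffun y => T (g y)] : {ffun C' -> 'I_n}).
    by move=> T; apply/ffunP=> y; rewrite !ffunE gK.
  by move=> T; apply/ffunP=> x; rewrite !ffunE fK.
rewrite -(on_card_preimset (onW_bij _ bij_h)); apply: eq_card => T.
rewrite !inE; apply/linextP/linextP => -[injT RT]; split.
- move=> y y' eqT; rewrite -(gK y) -(gK y'); congr f; apply: injT.
  by rewrite !ffunE !gK.
- by move=> y y'; rewrite -(gK y) -(gK y') !pf => /RT; rewrite !ffunE.
- by move=> x x'; rewrite !ffunE => /injT /(can_inj fK).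
- by move=> x x'; rewrite -!pf => /RT; rewrite !ffunE.
Qed.

(** Injective families with equal images differ by a bijection of their index types. This identifies
    a diagram with a corner deleted with the diagram of the smaller partition. *)
Lemma num_linext_eq (X : eqType) (R : rel X) (C C' : finType) (p : C -> X)
    (p' : C' -> X) (n : nat) :
  injective p -> injective p' ->
  (forall u, (exists x, p x = u) <-> (exists y, p' y = u)) ->
  num_linext R p n = num_linext R p' n.
Proof.
move=> injp injp' im.
have /fin_all_exists[f pf] x : exists y, p' y = p x by apply/im; exists x.
have /fin_all_exists[g pg] y : exists x, p x = p' y by apply/im; exists y.
apply: (num_linext_bij R n (f := f)) => //; exists g => x.
  by apply: injp; rewrite pg pf.
by apply: injp'; rewrite pf pg.
Qed.

(** By cardinality every label is used exactly once. The site of the largest label has nothing above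
    it for [R]; conversely, any labeling of the other sites extends by giving the largest label to a
    maximal site. *)
Lemma num_linext_rec (X : Type) (R : rel X) (C : finType) (p : C -> X)
    (n : nat) :
  #|C| = n.+1 ->
  num_linext R p n.+1 =
    \sum_(x | [forall y, ~~ R (p x) (p y)])
      num_linext R (fun y : {y | y != x} => p (val y)) n.
Proof.
move=> cardC; rewrite {1}/num_linext; set S := [set T | _].
(* Double counting: each labeling has exactly one site labeled [ord_max]. *)
have -> : #|S| = \sum_(T in S) \sum_(x | T x == ord_max) 1.
  rewrite -sum1_card; apply: eq_bigr => T; rewrite inE => /linextP[injT _].
  have [g TK gK] : bijective T.
    by apply: inj_card_bij; rewrite // card_ord cardC.
  rewrite (big_pred1 (g ord_max)) // => x.
  by rewrite /= -[RHS](inj_eq injT) gK.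
rewrite (exchange_big_dep predT) //=.
rewrite [RHS]big_mkcond; apply: eq_bigr => x _.
case: ifPn => [xmax|]; last first.
  rewrite negb_forall => /existsP[y]; rewrite negbK => Rxy.
  rewrite big_pred0 // => T; apply/negP=> /andP[]; rewrite inE.
  case/linextP=> _ /(_ _ _ Rxy) ltT /eqP Tx; move: ltT.
  by rewrite Tx ltnNge -ltnS ltn_ord.
(* [h] puts [x] back with the largest label; [lift ord_max] keeps the values of the other labels. *)
pose h (T : {ffun {y | y != x} -> 'I_n}) : {ffun C -> 'I_n.+1} :=
  [ffun y => oapp (fun z => lift ord_max (T z)) ord_max (insub y)].
have hx T : h T x = ord_max by rewrite ffunE insubF //= eqxx.
have hE T z : h T (val z) = lift ord_max (T z) by rewrite ffunE valK.
have inj_h : injective h.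
  move=> T T' eqT; apply/ffunP=> z; apply: (@lift_inj _ ord_max).
  by rewrite -!hE eqT.
rewrite sum1_card /num_linext -(card_imset _ inj_h); apply: eq_card => T.
apply/andP/imsetP => [[]|[T']].
  rewrite inE => /linextP[injT RT] /eqP Tx.
  have /fin_all_exists[g gT] (z : {y | y != x}) :
      exists i, T (val z) = lift ord_max i.
    have : ord_max != T (val z).
      by rewrite -Tx (inj_eq injT) eq_sym (valP z).
    by case/unlift_some=> i -> _; exists i.
  have TE : T = h [ffun z => g z].
    apply/ffunP=> y; have [->|ynx] := eqVneq y x; first by rewrite hx.
    by rewrite -[y]/(val (exist (fun y => y != x) y ynx)) hE ffunE gT.
  exists [ffun z => g z] => //; rewrite inE; apply/linextP; split.
    move=> z z' /(congr1 (lift ord_max)); rewrite -!hE -TE => /injT.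
    exact: val_inj.
  by move=> z z' /RT; rewrite TE !hE !lift_max.
rewrite inE => /linextP[injT RT] ->; split; last by rewrite hx.
rewrite inE; apply/linextP.
have cases y : y = x \/ exists z : {y | y != x}, y = val z.
  have [->|ynx] := eqVneq y x; [by left | by right; exists (exist _ y ynx)].
split=> y y'.
  case: (cases y) => [->|[z ->]]; case: (cases y') => [->|[z' ->]];
    rewrite ?hx ?hE //.
  - by move/eqP; rewrite (negPf (neq_lift _ _)).
  - by move/eqP; rewrite eq_sym (negPf (neq_lift _ _)).
  - by move/lift_inj/injT->.
case: (cases y) => [->|[z ->]]; first by move/forallP/(_ y'): xmax => /negPf->.
case: (cases y') => [->|[z' ->]]; rewrite ?hx ?hE ?lift_max ?ltn_ord //.
exact: RT.
Qed.

(** * Cells of Young diagrams and the branching rule *)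

Definition cell_pos (lam : seq nat) (c : young_cell lam) : nat * nat :=
  (cell_row c, cell_col c).

(** Only cells sharing a row or a column are compared, as in standardness. The relation is not
    transitive, but in the diagram of a partition its maximal cells are already the corners. *)
Definition cell_lt : rel (nat * nat) := fun u v =>
  (u.1 == v.1) && (u.2 < v.2) || (u.2 == v.2) && (u.1 < v.1).

Lemma num_sytE (lam : seq nat) :
  num_syt lam = num_linext cell_lt (@cell_pos lam) (sumn lam).
Proof.
apply: eq_card => T; rewrite !inE; apply/and3P/linextP.
  case=> /injectiveP injT rowT colT; split=> // x y /orP[] ltxy.
    by have /forallP/(_ y)/implyP := forallP rowT x; apply.
  by have /forallP/(_ y)/implyP := forallP colT x; apply.
case=> injT RT; split; first exact/injectiveP.
  apply/forallP=> x; apply/forallP=> y; apply/implyP=> ltxy.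
  by apply: RT; rewrite /cell_lt /= ltxy.
apply/forallP=> x; apply/forallP=> y; apply/implyP=> ltxy.
by apply: RT; rewrite /cell_lt /= ltxy orbT.
Qed.

Lemma cell_pos_inj (lam : seq nat) : injective (@cell_pos lam).
Proof.
move=> [i j] [i' j'] [] /=; rewrite /cell_row /cell_col /= => /val_inj eqi.
by subst i' => /val_inj->.
Qed.

(** The default 0 of [nth] makes the rows beyond the last one empty, which takes care of the bound
    on [i]. *)
Lemma cell_posP (lam : seq nat) (i j : nat) :
  (exists c : young_cell lam, cell_pos c = (i, j)) <-> j < nth 0 lam i.
Proof.
split=> [[[i' j'] [<- <-]]|ltj]; first exact: ltn_ord.
have lti : i < size lam.
  by rewrite ltnNge; apply: contraL ltj => /(nth_default 0)->.
by exists (existT (fun i : 'I_(size lam) => 'I_(nth 0 lam i))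
  (Ordinal lti) (Ordinal ltj)).
Qed.

Lemma card_young_cell (lam : seq nat) : #|{: young_cell lam}| = sumn lam.
Proof.
rewrite card_tagged sumnE big_map big_enum /= sumnE (big_nth 0) big_mkord.
by apply: eq_bigr => i _; rewrite card_ord.
Qed.

Lemma num_syt_rcons0 (lam : seq nat) : num_syt (rcons lam 0) = num_syt lam.
Proof.
rewrite !num_sytE sumn_rcons addn0.
apply: num_linext_eq => [||[i j]]; try exact: cell_pos_inj.
rewrite !cell_posP nth_rcons; case: (ltngtP i (size lam)) => // [lti|->].
  by rewrite nth_default // ltnW.
by rewrite nth_default.
Qed.

(** The largest entry sits in a corner, that is, at the end of a row strictly longer than the next
    one; deleting that cell lowers the part by 1. The last row is compared with the default 0. *)
Lemma num_syt_branch (lam : seq nat) :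
  sorted geq lam -> 0 < sumn lam ->
  num_syt lam =
    \sum_(0 <= i < size lam | nth 0 lam i.+1 < nth 0 lam i)
      num_syt (set_nth 0 lam i (nth 0 lam i).-1).
Proof.
move=> lam_sorted lam_gt0; rewrite big_mkord.
have lamP i j : i <= j -> nth 0 lam j <= nth 0 lam i.
  move=> leij; have [ltj|] := ltnP j (size lam); last by move/(nth_default 0)->.
  apply: (sorted_leq_nth _ _ 0 lam_sorted) => //; rewrite ?inE //.
  - by move=> a b c /= ba ac; apply: leq_trans ac ba.
  - by move=> a; apply: leqnn.
  - exact: leq_ltn_trans ltj.
have cardn : #|{: young_cell lam}| = (sumn lam).-1.+1.
  by rewrite card_young_cell prednK.
rewrite num_sytE -{1}(prednK lam_gt0) num_linext_rec //.
have maxE (x : young_cell lam) :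
    [forall y : young_cell lam, ~~ cell_lt (cell_pos x) (cell_pos y)] =
      (cell_col x == (nth 0 lam (cell_row x)).-1)
      && (nth 0 lam (cell_row x).+1 < nth 0 lam (cell_row x)).
  have xP : cell_col x < nth 0 lam (cell_row x).
    by apply/cell_posP; exists x.
  apply/forallP/andP => [xmax|[/eqP colx cornx] y].
    have colx : cell_col x == (nth 0 lam (cell_row x)).-1.
      rewrite eqn_leq -ltnS (ltn_predK xP) xP /=.
      rewrite leqNgt; apply/negP=> ltx.
      have /cell_posP[y posy] : (cell_col x).+1 < nth 0 lam (cell_row x).
        by rewrite -ltn_predRL.
      by move/negP: (xmax y); apply; rewrite posy /cell_lt /= eqxx ltnSn.
    split=> //; rewrite ltnNge; apply/negP=> lex.
    have /cell_posP[y posy] :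
        cell_col x < nth 0 lam (cell_row x).+1.
      exact: leq_trans xP lex.
    by move/negP: (xmax y); apply; rewrite posy /cell_lt /= eqxx ltnSn orbT.
  have yP : cell_col y < nth 0 lam (cell_row y).
    by apply/cell_posP; exists y.
  apply/negP=> /orP[] /= /andP[/eqP eqxy ltxy].
    by move: ltxy; rewrite colx eqxy ltnNge -ltnS (ltn_predK yP) yP.
  have rowE : nth 0 lam (cell_row x) = (cell_col x).+1.
    by rewrite colx prednK // (leq_ltn_trans _ cornx).
  (* A cell [y] below [x] in its column would make the row after that of [x], at least as long as
     the row of [y], reach past this column. *)
  move: cornx; rewrite rowE ltnS leqNgt => /negP; apply.
  by rewrite [X in X < _]eqxy; apply: leq_trans yP (lamP _ _ ltxy).
(* Corners are grouped by row: each row with a strict drop after it contains exactly one. *)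
rewrite (partition_big (fun x : young_cell lam => tag x)
  (fun i : 'I_(size lam) => nth 0 lam i.+1 < nth 0 lam i)) /=; last first.
  by move=> x; rewrite maxE => /andP[].
apply: eq_bigr => i corni.
have lami_gt0 : 0 < nth 0 lam i by apply: leq_ltn_trans corni.
have /cell_posP[x posx] : (nth 0 lam i).-1 < nth 0 lam i.
  by rewrite prednK.
have [rowx colx] : cell_row x = i /\ cell_col x = (nth 0 lam i).-1.
  by case: posx.
rewrite (big_pred1 x) => [|y]; last first.
  rewrite /= maxE; apply/andP/eqP => [[/andP[/eqP coly _] /eqP rowy]|->].
    apply: cell_pos_inj; rewrite posx /cell_pos coly.
    by rewrite /cell_row rowy.
  by rewrite rowx colx eqxx corni; split=> //; apply/eqP/val_inj.
rewrite num_sytE.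
have -> : sumn (set_nth 0 lam i (nth 0 lam i).-1) = (sumn lam).-1.
  by rewrite sumn_set_nth_ltn //; lia.
apply: num_linext_eq; first by move=> y z /cell_pos_inj/val_inj.
  exact: cell_pos_inj.
move=> [i' j']; rewrite cell_posP nth_set_nth /=.
split=> [[y [<- <-]]|ltj].
  have yP : cell_col (val y) < nth 0 lam (cell_row (val y)).
    by apply/cell_posP; exists (val y).
  case: eqP => // /= rowy; rewrite -rowy ltn_neqAle -ltnS prednK; last first.
    exact: leq_ltn_trans yP.
  rewrite yP andbT; apply/eqP=> coly.
  move: (valP y); rewrite -(inj_eq (@cell_pos_inj _)).
  by rewrite posx /cell_pos coly rowy eqxx.
have /cell_posP[y posy] : j' < nth 0 lam i'.
  by move: ltj; case: eqP => [->|//]; move/leq_trans; apply; apply: leq_pred.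
have ynx : y != x.
  apply: contraTneq ltj => eqyx; move: posy; rewrite eqyx posx => -[<- <-].
  by rewrite eqxx ltnn.
by exists (exist _ y ynx).
Qed.

Lemma num_syt_nil : num_syt [::] = 1.
Proof.
have no_cell : young_cell [::] -> False by case=> -[].
rewrite /num_syt (_ : [set T | _] = setT).
  rewrite cardsT card_ffun (card_young_cell [::]) //.
apply/setP=> T; rewrite !inE; apply/and3P; split.
- by apply/injectiveP=> x; case: (no_cell x).
- by apply/forallP=> x; case: (no_cell x).
- by apply/forallP=> x; case: (no_cell x).
Qed.

(** * Hook formulas for three rows and for two rows with a column of ones *)

Lemma num_syt3_rec (a b c : nat) :
  c <= b -> b <= a -> 0 < a ->
  num_syt [:: a; b; c] =
    (if b < a then num_syt [:: a.-1; b; c] else 0) +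
    (if c < b then num_syt [:: a; b.-1; c] else 0) +
    (if 0 < c then num_syt [:: a; b; c.-1] else 0).
Proof.
move=> lecb leba a_gt0.
have sorted3 : sorted geq [:: a; b; c] by rewrite /= leba lecb.
rewrite num_syt_branch //=; last by rewrite addn_gt0 a_gt0.
by rewrite big_mkcond !big_nat_recr //= big_nil.
Qed.

(** Among the parts equal to 1 only the last is a corner, and the second row can shrink only if it
    is longer than 1. Deleting the last one leaves a trailing zero, which [num_syt_rcons0] drops. *)
Lemma num_syt_two_row_ones_rec (a b t : nat) :
  0 < b -> b <= a ->
  num_syt (two_row_ones a b t.+1) =
    (if b < a then num_syt (two_row_ones a.-1 b t.+1) else 0) +
    (if 1 < b then num_syt (two_row_ones a b.-1 t.+1) else 0) +
    num_syt (two_row_ones a b t).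
Proof.
move=> b_gt0 leba.
have lam_sorted : sorted geq (two_row_ones a b t.+1).
  by rewrite /= leba b_gt0 /=; elim: (t) => //= n ->.
rewrite num_syt_branch //; last by rewrite /= addnCA addn_gt0 b_gt0.
rewrite big_mkcond /= size_nseq big_nat_recr //= 2?big_nat_recl //=.
have nth1 i : i <= t -> nth 0 (1 :: nseq t 1) i = 1.
  by move=> leit; rewrite -[_ :: _]/(nseq t.+1 1) nth_nseq ltnS leit.
rewrite big_nat big1 => [|i /andP[_ lti]]; last first.
  by rewrite nth1 ?nth_nseq ?lti // ltnW.
rewrite nth1 // nth_nseq ltnn !addn0.
rewrite -(num_syt_rcons0 (two_row_ones a b t)) /two_row_ones /=.
congr (_ + _ + num_syt [:: a, b & _]).
by elim: (t) => //= n ->.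
Qed.

Local Open Scope ring_scope.

Lemma natr_factS (n : nat) : (n.+1`!)%:R = n.+1%:R * n`!%:R :> rat.
Proof. by rewrite factS natrM. Qed.

(** The linear factors are the differences of the shifted parts [a + 2], [b + 1], [c], as in the
    Frobenius degree formula. With denominators cleared, the branching step becomes a polynomial
    identity for [ring]. *)
Lemma num_syt3_mulE (a b c : nat) :
  (c <= b)%N -> (b <= a)%N ->
  (num_syt [:: a; b; c])%:R * (a.+2`!%:R * b.+1`!%:R * c`!%:R) =
    (a + b + c)`!%:R * (a%:R - b%:R + 1) * (a%:R - c%:R + 2%:R) *
    (b%:R - c%:R + 1) :> rat.
Proof.
elim: {a b c}(a + b + c)%N {-2}a {-2}b {-2}c (erefl (a + b + c)%N)
  => [|n IHn] a b c.
  move=> sumE _ _; have [-> [-> ->]] : a = 0%N /\ b = 0%N /\ c = 0%N by lia.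
  rewrite (num_syt_rcons0 [:: 0; 0]%N) (num_syt_rcons0 [:: 0]%N).
  rewrite (num_syt_rcons0 [::]).
  by rewrite num_syt_nil !natr_factS fact0 /=; ring.
move=> sumE lecb leba; rewrite num_syt3_rec //; last by lia.
set f1 := if (b < a)%N then _ else _; set f2 := if (c < b)%N then _ else _.
set f3 := if (0 < c)%N then _ else _; set D : rat := _`!%:R * _ * _.
(* In [E1], [E2], [E3] the factors [a - b], [b - c] and [c] vanish exactly when the corresponding
   cell is not removable, so the zero branches obey the same formulas. *)
have E1 : f1%:R * D
    = n`!%:R * ((a%:R - b%:R) * (a%:R - c%:R + 1) *
      (b%:R - c%:R + 1) * (a%:R + 2%:R)) :> rat.
  rewrite /f1 /D {f1 f2 f3 D}.
  have [ltba|] := ltnP b a; last first.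
    by move=> leab; have -> : a = b by [lia]; ring.
  case: a ltba sumE leba => // a ltba sumE leba /=.
  rewrite (natr_factS a.+2).
  have := IHn a b c; rewrite (_ : a + b + c = n)%N; last by lia.
  move=> /(_ erefl lecb ltba) IH.
  transitivity (a.+3%:R *
    ((num_syt [:: a; b; c])%:R * (a.+2`!%:R * b.+1`!%:R * c`!%:R) : rat)).
    by ring.
  by rewrite IH -[a.+3]addn3 -[a.+1]addn1 !natrD; ring.
have E2 : f2%:R * D
    = n`!%:R * ((a%:R - b%:R + 2%:R) * (a%:R - c%:R + 2%:R) *
      (b%:R - c%:R) * (b%:R + 1)) :> rat.
  rewrite /f2 /D {E1 f1 f2 f3 D}.
  have [ltcb|] := ltnP c b; last first.
    by move=> lebc; have -> : b = c by [lia]; ring.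
  case: b ltcb sumE leba lecb => // b ltcb sumE leba lecb /=.
  rewrite (natr_factS b.+1).
  have := IHn a b c; rewrite (_ : a + b + c = n)%N; last by lia.
  move=> /(_ erefl ltcb (ltnW leba)) IH.
  transitivity (b.+2%:R *
    ((num_syt [:: a; b; c])%:R * (a.+2`!%:R * b.+1`!%:R * c`!%:R) : rat)).
    by ring.
  by rewrite IH -[b.+2]addn2 -[b.+1]addn1 !natrD; ring.
have E3 : f3%:R * D
    = n`!%:R * ((a%:R - b%:R + 1) * (a%:R - c%:R + 3%:R) *
      (b%:R - c%:R + 2%:R) * c%:R) :> rat.
  rewrite /f3 /D {E1 E2 f1 f2 f3 D}.
  case: c sumE lecb => [|c] sumE lecb /=; first by ring.
  rewrite (natr_factS c).
  have := IHn a b c; rewrite (_ : a + b + c = n)%N; last by lia.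
  move=> /(_ erefl (ltnW lecb) leba) IH.
  transitivity (c.+1%:R *
    ((num_syt [:: a; b; c])%:R * (a.+2`!%:R * b.+1`!%:R * c`!%:R) : rat)).
    by ring.
  by rewrite IH -[c.+1]addn1 !natrD; ring.
rewrite sumE (natr_factS n) -sumE !natrD !mulrDl E1 E2 E3; ring.
Qed.

(** The hooks in the first column of the two long rows are [a + t + 1] and [b + t + 1]. The column
    of ones contributes [t!], the rest of the second row [b!], the rest of the first row
    [a! / (a - b)]. *)
Lemma num_syt_two_row_onesE (a b t : nat) :
  (b < a)%N ->
  (num_syt (two_row_ones a b.+1 t))%:R =
    (a + b.+1 + t)`!%:R * (a%:R - b%:R) /
    ((a + t).+1%:R * (b + t).+1%:R * a`!%:R * b`!%:R * t`!%:R) :> rat.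
Proof.
have fact_neq0 i : i`!%:R != 0 :> rat by rewrite pnatr_eq0 -lt0n fact_gt0.
elim: {a b t}(a + b + t)%N {-2}a {-2}b {-2}t (erefl (a + b + t)%N)
  => [|n IHn] a b t sumE ltba.
  by lia.
(* The branching rule above assumes at least one part in the column of ones; the case [t = 0] comes
   from the three-row formula with third part 0. *)
case: t sumE => [|t] sumE.
  have := num_syt3_mulE (leq0n b.+1) ltba.
  rewrite (num_syt_rcons0 [:: a; b.+1]).
  rewrite !addn0 -[[:: a; b.+1]]/(two_row_ones a b.+1 0) => E.
  have D_neq0 : a.+2`!%:R * b.+2`!%:R * 0`!%:R != 0 :> rat.
    by rewrite !mulf_neq0.
  apply: (mulIf D_neq0); rewrite E !natr_factS fact0.
  have := fact_neq0 a; have := fact_neq0 b.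
  move: a`!%:R b`!%:R (a + b.+1)`!%:R => x y w x0 y0.
  (* The denominators left by [field] are folded back into casts of successors, hence nonzero. *)
  by field; rewrite x0 y0 !(nat1r, =^~ natrD) !pnatr_eq0.
have {}sumE : (a + b.+1 + t = n.+1)%N by lia.
rewrite num_syt_two_row_ones_rec // (_ : a + b.+1 + t.+1 = n.+2)%N; last by lia.
rewrite (natr_factS n.+1).
set f1 := if (b.+1 < a)%N then _ else _.
set f2 := if (1 < b.+1)%N then _ else _.
set f3 := num_syt (two_row_ones a b.+1 t).
pose D : rat := a`!%:R * b`!%:R * t.+1`!%:R.
(* The zero branches are absorbed again: [a - 1 - b] vanishes if the first row cannot shrink, and
   the factor [b] in [E2] if the second cannot. *)
have E1 : f1%:R =
    n.+1`!%:R * (a%:R - 1 - b%:R) * a%:R /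
    ((a + t).+1%:R * (b + t).+2%:R * D) :> rat.
  rewrite /f1 /D {f1 f2 f3 D}; have [ltSba|] := ltnP b.+1 a; last first.
    move=> leaSb; have -> : a = b.+1 by [lia].
    by rewrite -natr1 addrK subrr mulr0 !mul0r.
  case: a ltSba sumE ltba => // a ltSba sumE ltba /=.
  rewrite (IHn a b t.+1) //; [|lia].
  rewrite (_ : a + b.+1 + t.+1 = n.+1)%N ?(natr_factS a); last by lia.
  have := fact_neq0 a; have := fact_neq0 b; have := fact_neq0 t.+1.
  move: a`!%:R b`!%:R t.+1`!%:R n.+1`!%:R => x y z w x0 y0 z0.
  field.
  by rewrite x0 y0 z0 !(nat1r, =^~ natrD) !pnatr_eq0.
have E2 : f2%:R =
    n.+1`!%:R * (a%:R + 1 - b%:R) * b%:R /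
    ((a + t).+2%:R * (b + t).+1%:R * D) :> rat.
  rewrite /f2 /D {E1 f1 f2 f3 D}.
  case: b sumE ltba => [|b] sumE ltba; first by rewrite /= mulr0 mul0r.
  rewrite /= (IHn a b t.+1) //; [|lia|lia].
  rewrite (_ : a + b.+1 + t.+1 = n.+1)%N ?(natr_factS b); last by lia.
  have := fact_neq0 a; have := fact_neq0 b; have := fact_neq0 t.+1.
  move: a`!%:R b`!%:R t.+1`!%:R n.+1`!%:R => x y z w x0 y0 z0.
  field.
  by rewrite x0 y0 z0 !(nat1r, =^~ natrD) !pnatr_eq0.
have E3 : f3%:R =
    n.+1`!%:R * (a%:R - b%:R) * t.+1%:R /
    ((a + t).+1%:R * (b + t).+1%:R * D) :> rat.
  rewrite /f3 /D {E1 E2 f1 f2 f3 D} IHn //; [|lia].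
  rewrite sumE (natr_factS t).
  have := fact_neq0 a; have := fact_neq0 b; have := fact_neq0 t.
  move: a`!%:R b`!%:R t`!%:R n.+1`!%:R => x y z w x0 y0 z0.
  field.
  by rewrite x0 y0 z0 !(nat1r, =^~ natrD) !pnatr_eq0.
rewrite (natrD _ (f1 + f2)%N) (natrD _ f1) E1 E2 E3 /D {E1 E2 E3 f1 f2 f3 D}.
have -> : n.+2%:R = a%:R + b%:R + t%:R + 2%:R :> rat.
  by rewrite -!natrD; congr _%:R; lia.
have := fact_neq0 a; have := fact_neq0 b; have := fact_neq0 t.+1.
move: a`!%:R b`!%:R t.+1`!%:R n.+1`!%:R => x y z w x0 y0 z0.
field.
by rewrite x0 y0 z0 !(nat1r, =^~ natrD) !pnatr_eq0.
Qed.

Lemma num_syt3E (a b c : nat) :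
  (c <= b)%N -> (b <= a)%N ->
  (num_syt [:: a; b; c])%:R =
    (a + b + c)`!%:R * (a%:R - b%:R + 1) * (a%:R - c%:R + 2%:R) *
    (b%:R - c%:R + 1) / (a.+2`!%:R * b.+1`!%:R * c`!%:R) :> rat.
Proof.
move=> lecb leba; rewrite -num_syt3_mulE // mulfK //.
by rewrite !mulf_neq0 // pnatr_eq0 -lt0n fact_gt0.
Qed.

(** * Linear relations between the two families of shapes *)

(** All five shapes have the same size, so its factorial is a common factor and the hook formulas
    leave an identity of rational functions. Negative terms are moved across because subtraction in
    [nat] truncates. *)
Lemma num_syt3_two_row_ones (a b c : nat) :
  (c.+4 <= b)%N -> (b.+2 <= a)%N ->
  (num_syt [:: a; b; c.+4] + num_syt (two_row_ones a.+2 b c.+2) +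
   num_syt (two_row_ones a b.+2 c.+2) =
   num_syt (two_row_ones a b c.+4) + num_syt (two_row_ones a.+2 b.+2 c))%N.
Proof.
case: b => // b lecb leba; apply/eqP; rewrite -(eqr_nat rat); apply/eqP.
rewrite [LHS]natrD [X in X + _]natrD [RHS]natrD.
rewrite num_syt3E ?num_syt_two_row_onesE //; try lia.
have -> : (a.+2 + b.+1 + c.+2 = a + b.+1 + c.+4)%N by lia.
have -> : (a + b.+3 + c.+2 = a + b.+1 + c.+4)%N by lia.
have -> : (a.+2 + b.+3 + c = a + b.+1 + c.+4)%N by lia.
rewrite !natr_factS.
have fact_neq0 i : i`!%:R != 0 :> rat by rewrite pnatr_eq0 -lt0n fact_gt0.
have := fact_neq0 a; have := fact_neq0 b; have := fact_neq0 c.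
move: a`!%:R b`!%:R c`!%:R (a + b.+1 + c.+4)`!%:R => x y z w x0 y0 z0.
field.
by rewrite x0 y0 z0 !(nat1r, =^~ natrD) !pnatr_eq0.
Qed.

(** For [b = a] the shape with rows [a], [a + 2] is not a partition. The hook formula, extended
    formally, changes sign under [(x, y) -> (y - 1, x + 1)], which replaces these rows by [a + 1],
    [a + 1] on the other side. *)
Lemma num_syt3_two_row_ones_diag (a c : nat) :
  (c.+4 <= a)%N ->
  (num_syt [:: a; a; c.+4] + num_syt (two_row_ones a.+2 a c.+2) =
   num_syt (two_row_ones a a c.+4) + num_syt (two_row_ones a.+1 a.+1 c.+2) +
   num_syt (two_row_ones a.+2 a.+2 c))%N.
Proof.
case: a => // a leca; apply/eqP; rewrite -(eqr_nat rat); apply/eqP.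
rewrite [LHS]natrD [RHS]natrD [X in _ = X + _]natrD.
rewrite num_syt3E ?num_syt_two_row_onesE //; try lia.
have -> : (a.+3 + a.+1 + c.+2 = a.+1 + a.+1 + c.+4)%N by lia.
have -> : (a.+2 + a.+2 + c.+2 = a.+1 + a.+1 + c.+4)%N by lia.
have -> : (a.+3 + a.+3 + c = a.+1 + a.+1 + c.+4)%N by lia.
move: (a.+1 + a.+1 + c.+4)`!%:R => w; rewrite !natr_factS.
have fact_neq0 i : i`!%:R != 0 :> rat by rewrite pnatr_eq0 -lt0n fact_gt0.
have := fact_neq0 a; have := fact_neq0 c.
move: a`!%:R c`!%:R => x z x0 z0.
field.
by rewrite x0 z0 !(nat1r, =^~ natrD) !pnatr_eq0.
Qed.

Local Close Scope ring_scope.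

(** * Telescoping and the induction on [d] *)

(** The first part and the size stay fixed while the second part climbs by 2 up to the first, where
    the diagonal relation ends the sum. The hypothesis bounds the largest third part by the smallest
    second part. *)
Lemma sum_num_syt3 (e b x : nat) :
  x + 2 * e + 4 <= b ->
  \sum_(0 <= j < e.+1)
     num_syt [:: b + 2 * e; b + 2 * j; x + 4 + 2 * (e - j)] +
  num_syt (two_row_ones (b + 2 * e).+2 b (x + 2 * e).+2) =
  num_syt (two_row_ones (b + 2 * e) b (x + 2 * e + 4)) +
  num_syt (two_row_ones (b + 2 * e).+1 (b + 2 * e).+1 x.+2) +
  num_syt (two_row_ones (b + 2 * e).+2 (b + 2 * e).+2 x).
Proof.
elim: e b => [|e IHe] b leb.
  rewrite big_nat1 !muln0 !addn0 !addn4.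
  by apply: num_syt3_two_row_ones_diag; lia.
rewrite big_nat_recl // muln0 addn0 subn0.
have {IHe} := IHe b.+2; rewrite (_ : b.+2 + 2 * e = b + 2 * e.+1); last by lia.
move/(_ ltac:(lia)); set s := \sum_(0 <= j < e.+1) _.
have -> : \sum_(0 <= i < e.+1)
    num_syt [:: b + 2 * e.+1; b + 2 * i.+1; x + 4 + 2 * (e.+1 - i.+1)] = s.
  by apply: eq_bigr => i _; congr num_syt; congr [:: _; _; _]; lia.
(* This relation for [j = 0] shares two terms with the induction hypothesis at [b.+2]: those with
   second part [b + 2] and first part [b + 2 * e.+1] or two more. They cancel on addition. *)
have := @num_syt3_two_row_ones (b + 2 * e.+1) b (x + 2 * e.+1).
rewrite (_ : x + 4 + 2 * e.+1 = (x + 2 * e.+1).+4); last by lia.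
move/(_ ltac:(lia) ltac:(lia)).
rewrite (addn4 (x + 2 * e.+1)).
rewrite (_ : x + 2 * e + 4 = (x + 2 * e.+1).+2); last by lia.
rewrite (_ : (x + 2 * e).+2 = x + 2 * e.+1); last by lia.
lia.
Qed.

Theorem theorem4p2 (d k m : nat) (hk : 2 <= k) (hm : 2 <= m)
    (hmd : 4 * d <= m) (hmk : m <= k) :
  L_odd d k m =
    num_syt (two_row_ones (k + 2 * d) k (m - 2 * d)) +
    \sum_(0 <= r < d) \sum_(0 <= j < r.+1)
      num_syt [:: k + 2 * r; k + 2 * j; m - 2 * (r + j)].
Proof.
elim: d hmd => [|d IHd] hmd.
  by rewrite /L_odd big_nat1 big_nil !muln0 !subn0 !addn0.
(* Passing to [d.+1] adds the summand [r = d] on the right and the terms [j = 2d + 1] and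
   [j = 2d + 2] of [L_odd] on the left. *)
rewrite big_nat_recr //= /L_odd (_ : 2 * d.+1 = (2 * d).+2); last by lia.
rewrite big_nat_recr // big_nat_recr //= -/(L_odd d k m) IHd; last by lia.
(* [x] is the number of ones in the last term of [L_odd]; expressing [m] through it removes the
   truncated subtractions. *)
have [x mE] : exists x, m = 4 * d + 4 + x by exists (m - (4 * d + 4)); lia.
(* The side condition amounts to [m - 2 * d <= k], which follows from [hmk]. *)
have := @sum_num_syt3 d k x ltac:(lia).
have -> : \sum_(0 <= j < d.+1)
    num_syt [:: k + 2 * d; k + 2 * j; x + 4 + 2 * (d - j)] =
  \sum_(0 <= j < d.+1) num_syt [:: k + 2 * d; k + 2 * j; m - 2 * (d + j)].
  by apply: eq_big_nat => j ltj; congr num_syt; congr [:: _; _; _]; lia.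
rewrite !(addnS k).
rewrite (_ : m - 2 * d = x + 2 * d + 4); last by lia.
rewrite (_ : m - 2 * (2 * d).+1 = x.+2); last by lia.
rewrite (_ : m - 2 * (2 * d).+2 = x); last by lia.
rewrite (_ : m - (2 * d).+2 = (x + 2 * d).+2); last by lia.
lia.
Qed.
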